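(* Let $V$ be the $\mathbb{C}$-vector space with basis $d_1,\dots,d_n$, and let $\zeta_{i,k,l}\in\mathbb{C}$ and $\xi_{i,k,l}(t)\in\mathbb{C}[t]$ ($1\le i,k,l\le n$) be such that $$q_kq_l-\sum_{i=1}^n\bigl(\zeta_{i,k,l}\,q_i+t\,\xi_{i,k,l}(t)\,q_i\bigr)\in I\qquad\text{for all }k,l\in\{1,\dots,n\}.$$ Then the multiplication rule $$d_k\ast_t d_l=\sum_{i=1}^n\bigl(\zeta_{i,k,l}\,d_i+t\,\xi_{i,k,l}(t)\,d_i\bigr)$$ gives a formal deformation such that $\ast_0$ gives the multiplication on an algebra isomorphic to $N$. That is, the $\mathbb{C}[t]$-bilinear extension of $\ast_t$ to $V[t]$ is associative, and $V$ with the product $\ast_0$ obtained by setting $t=0$ is isomorphic to $N$.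
   Context: Let $A$ be an associative unital finite-dimensional $\mathbb{C}$-algebra and $n=\dim_{\mathbb{C}}A$. $\mathbb{C}[x,y]$ denotes the free associative unital $\mathbb{C}$-algebra in non-commuting variables $x,y$, and $\mathbb{C}[x,y][t]$ the polynomial ring over it in a central variable $t$. Let $m\ge1$ and $a_1,\dots,a_m,b_1,\dots,b_m\in A$ be such that $\sum_{i=1}^m a_i$ and $\sum_{i=1}^m b_i$ generate $A$ as a $\mathbb{C}$-algebra. Let $f:\mathbb{C}[x,y][t]\to A[t]$ be the homomorphism of $\mathbb{C}$-algebras with $f(x)=\sum_{i=1}^m a_it^i$, $f(y)=\sum_{i=1}^m b_it^i$, $f(t)=t$, and let $I=\ker f$. Standing assumption: for every $r\in A$ there is $i=i(r)\in\mathbb{N}$ with $rt^i\in\operatorname{im}f$. Let $p_1<p_2<\cdots$ be the monomials of $\mathbb{C}[x,y]$ in shortlex order with $1<x<y$. Let $q_1,\dots,q_n\in\mathbb{C}[x,y][t]$ be elements such that $f(p_k)\in\sum_{i=1}^n\mathbb{C}[t]f(q_i)$ for every $k$ (such elements exist). For each $k\in\mathbb{N}$ let $\zeta_{i,k}\in\mathbb{C}$, $\xi_{i,k}(t)\in\mathbb{C}[t]$ be such that $p_k-\sum_{i=1}^n(\zeta_{i,k}q_i+t\xi_{i,k}(t)q_i)\in I$ (they exist). Write $q_i^0\in\mathbb{C}[x,y]$ for the image of $q_i$ under $t\mapsto0$ (so $q_i^0=q_i$ if $q_i\in\mathbb{C}[x,y]$). Let $J$ be the set of $\mathbb{C}$-linear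 combinations of the elements $p_k-\sum_{i=1}^n\zeta_{i,k}q_i^0\in\mathbb{C}[x,y]$, $k\in\mathbb{N}$, let $\langle J\rangle$ be the ideal of $\mathbb{C}[x,y]$ it generates, and $N=\mathbb{C}[x,y]/\langle J\rangle$. A formal deformation of a $\mathbb{C}$-algebra $B$ is an associative $\mathbb{C}[t]$-bilinear multiplication on $B[t]$ which at $t=0$ specializes to the multiplication of $B$. *)

(* Defs.v *)
From HB Require Import structures.
From mathcomp Require Import all_boot all_order all_algebra all_field.
From mathcomp Require Import boolp classical_sets reals.
From mathcomp Require Import complex monalg.

Set Implicit Arguments.
Unset Strict Implicit.
Unset Printing Implicit Defensive.

Import GRing.Theory.
Local Open Scope ring_scope.
Local Open Scope quotient_scope.

Definition ncpoly (K : comNzRingType) := {malg K[{fmonom 'I_2}]}.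
HB.instance Definition _ (K : comNzRingType) :=
  GRing.Lalgebra.on (ncpoly K).

Definition ncmon (K : comNzRingType) (w : {fmonom 'I_2}) : ncpoly K :=
  mkmalgU w 1.
Definition ncx (K : comNzRingType) : ncpoly K := ncmon K (fmu ord0).
Definition ncy (K : comNzRingType) : ncpoly K := ncmon K (fmu ord_max).

Definition shortlex (u v : {fmonom 'I_2}) : bool :=
  (size u < size v)%N ||
  ((size u == size v) && ((u : seqlexi 'I_2) < (v : seqlexi 'I_2))%O).

(* These two conditions determine p; indices start at 0, so p 0 is the empty
   word (the monomial 1). *)
Definition shortlex_enum (p : nat -> {fmonom 'I_2}) : Prop :=
  (forall k l, (k < l)%N -> shortlex (p k) (p l)) /\
  (forall w, exists k, p k = w).

(* The K[t]-module structure of B[t]; the library's scaling on {poly B} is by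
   elements of B. *)
Definition scalet (K : comNzRingType) (B : lalgType K)
    (g : {poly K}) (u : {poly B}) : {poly B} :=
  map_poly (in_alg B) g * u.

Definition lin_span (K : nzRingType) (W : lmodType K) (g : nat -> W) : set W :=
  [set u | exists (m : nat) (c : nat -> K), u = \sum_(k < m) c k *: g k].

Definition two_sided_ideal (B : pzRingType) (S : set B) : Prop :=
  [/\ S 0,
      forall u v, S u -> S v -> S (u - v),
      forall a u, S u -> S (a * u) &
      forall a u, S u -> S (u * a)].

Definition gen_ideal (B : pzRingType) (J : set B) : set B :=
  smallest (@two_sided_ideal B) J.

Lemma gen_idealP (B : pzRingType) (J : set B) :
  two_sided_ideal (gen_ideal J).
Proof.
split.
- by move=> S [[]].
- by move=> u v Ju Jv S [iS JS]; case: (iS) => _ h _ _;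
    apply: h; [exact: Ju | exact: Jv].
- by move=> a u Ju S [iS JS]; case: (iS) => _ _ h _; apply: h; exact: Ju.
- by move=> a u Ju S [iS JS]; case: (iS) => _ _ _ h; apply: h; exact: Ju.
Qed.

(* The library only builds quotient rings of commutative rings by proper
   ideals; here B / <J> as a K-algebra for an arbitrary algebra B, with the
   zero ring allowed. *)
Section QuotientAlgebra.
Context (K : nzRingType) (B : lalgType K) (J : set B).

Definition gen_ideal_pred : {pred B} := fun u => `[< gen_ideal J u >].

Lemma gen_ideal_predE u : (u \in gen_ideal_pred) = `[< gen_ideal J u >].
Proof. by []. Qed.

Fact gen_ideal_zmod_closed : zmod_closed gen_ideal_pred.
Proof.
have [J0 JB _ _] := gen_idealP J; split; first exact/asboolP.
by move=> u v /asboolP Ju /asboolP Jv; apply/asboolP; exact: JB.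
Qed.
HB.instance Definition _ :=
  GRing.isZmodClosed.Build B gen_ideal_pred gen_ideal_zmod_closed.

Definition quot_alg := Quotient.quot gen_ideal_pred.
HB.instance Definition _ := GRing.Zmodule.on quot_alg.
HB.instance Definition _ := Quotient.on quot_alg.

Definition quot_alg_pi (u : B) : quot_alg := \pi_quot_alg u.
Definition quot_alg_one : quot_alg := quot_alg_pi 1.
Definition quot_alg_mul (a b : quot_alg) : quot_alg :=
  quot_alg_pi (repr a * repr b).
Definition quot_alg_scale (c : K) (a : quot_alg) : quot_alg :=
  quot_alg_pi (c *: repr a).

Lemma quot_alg_piE u v :
  quot_alg_pi u = quot_alg_pi v <-> gen_ideal J (u - v).
Proof.
rewrite /quot_alg_pi; split => [/eqP | h].
  by rewrite -Quotient.idealrBE gen_ideal_predE => /asboolP.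
by apply/eqP; rewrite -Quotient.idealrBE gen_ideal_predE; apply/asboolP.
Qed.

Lemma quot_alg_reprK a : quot_alg_pi (repr a) = a.
Proof. exact: reprK. Qed.

Lemma quot_alg_repr_pi u : gen_ideal J (repr (quot_alg_pi u) - u).
Proof. by apply/quot_alg_piE; rewrite quot_alg_reprK. Qed.

Lemma quot_alg_piD u v : quot_alg_pi (u + v) = quot_alg_pi u + quot_alg_pi v.
Proof. by rewrite /quot_alg_pi !piE. Qed.

Lemma quot_alg_piM u v :
  quot_alg_pi (u * v) = quot_alg_mul (quot_alg_pi u) (quot_alg_pi v).
Proof.
have [J0 JB Jl Jr] := gen_idealP J.
apply/quot_alg_piE; set u' := repr _; set v' := repr _.
have -> : u * v - u' * v' = 0 - (u' - u) * v - u' * (v' - v).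
  by rewrite mulrBl mulrBr sub0r !opprB addrA subrK.
apply: (JB); last by apply: Jl; exact: quot_alg_repr_pi.
by apply: JB => //; apply: Jr; exact: quot_alg_repr_pi.
Qed.

Lemma quot_alg_piZ c u :
  quot_alg_pi (c *: u) = quot_alg_scale c (quot_alg_pi u).
Proof.
have [J0 JB Jl _] := gen_idealP J.
apply/quot_alg_piE; rewrite -scalerBr -mulr_algl; apply: Jl.
by rewrite -opprB -sub0r; apply: JB => //; exact: quot_alg_repr_pi.
Qed.

Lemma quot_alg_ind (P : quot_alg -> Prop) :
  (forall u, P (quot_alg_pi u)) -> forall a, P a.
Proof. by move=> h a; rewrite -[a]quot_alg_reprK. Qed.

Fact quot_alg_mulA : associative quot_alg_mul.
Proof.
elim/quot_alg_ind => u; elim/quot_alg_ind => v; elim/quot_alg_ind => w.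
by rewrite -!quot_alg_piM mulrA.
Qed.
Fact quot_alg_mul1l : left_id quot_alg_one quot_alg_mul.
Proof. by elim/quot_alg_ind => u; rewrite -quot_alg_piM mul1r. Qed.
Fact quot_alg_mul1r : right_id quot_alg_one quot_alg_mul.
Proof. by elim/quot_alg_ind => u; rewrite -quot_alg_piM mulr1. Qed.
Fact quot_alg_mulDl : left_distributive quot_alg_mul +%R.
Proof.
elim/quot_alg_ind => u; elim/quot_alg_ind => v; elim/quot_alg_ind => w.
by rewrite -quot_alg_piD -!quot_alg_piM mulrDl quot_alg_piD.
Qed.
Fact quot_alg_mulDr : right_distributive quot_alg_mul +%R.
Proof.
elim/quot_alg_ind => u; elim/quot_alg_ind => v; elim/quot_alg_ind => w.
by rewrite -quot_alg_piD -!quot_alg_piM mulrDr quot_alg_piD.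
Qed.
HB.instance Definition _ := GRing.Zmodule_isPzRing.Build quot_alg
  quot_alg_mulA quot_alg_mul1l quot_alg_mul1r quot_alg_mulDl quot_alg_mulDr.

Fact quot_alg_scaleA c d a :
  quot_alg_scale c (quot_alg_scale d a) = quot_alg_scale (c * d) a.
Proof. by elim/quot_alg_ind: a => u; rewrite -!quot_alg_piZ scalerA. Qed.
Fact quot_alg_scale1 : left_id 1 quot_alg_scale.
Proof. by elim/quot_alg_ind => u; rewrite -quot_alg_piZ scale1r. Qed.
Fact quot_alg_scaleDr : right_distributive quot_alg_scale +%R.
Proof.
move=> c; elim/quot_alg_ind => u; elim/quot_alg_ind => v.
by rewrite -quot_alg_piD -!quot_alg_piZ scalerDr quot_alg_piD.
Qed.
Fact quot_alg_scaleDl a : {morph quot_alg_scale^~ a : c d / c + d}.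
Proof.
move=> c d; elim/quot_alg_ind: a => u.
by rewrite -!quot_alg_piZ scalerDl quot_alg_piD.
Qed.
HB.instance Definition _ := GRing.Zmodule_isLmodule.Build K quot_alg
  quot_alg_scaleA quot_alg_scale1 quot_alg_scaleDr quot_alg_scaleDl.

End QuotientAlgebra.

(* 'rV_n is the free module with basis d_i = delta_mx 0 i; for V = 'rV[K]_n,
   V[t] is 'rV[{poly K}]_n. *)
Definition bilin_ext (S : comNzRingType) (n : nat)
    (T : 'I_n -> 'I_n -> 'rV[S]_n) (u v : 'rV[S]_n) : 'rV[S]_n :=
  \sum_(k < n) \sum_(l < n) (u 0 k * v 0 l) *: T k l.

Definition at_t0 (K : comNzRingType) (n : nat) (u : 'rV[{poly K}]_n) :
  'rV[K]_n := map_mx (fun g : {poly K} => g.[0]) u.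

Definition const_t (K : comNzRingType) (n : nat) (u : 'rV[K]_n) :
  'rV[{poly K}]_n := map_mx polyC u.

Definition formal_deformation (K : comNzRingType) (n : nat)
    (mu : 'rV[K]_n -> 'rV[K]_n -> 'rV[K]_n)
    (mut : 'rV[{poly K}]_n -> 'rV[{poly K}]_n -> 'rV[{poly K}]_n) : Prop :=
  [/\ (forall u, linear (mut u)) /\ (forall v, linear (mut^~ v)),
      associative mut &
      forall u v, at_t0 (mut (const_t u) (const_t v)) = mu u v].

(* Main.v *)
Require Import Defs.
From HB Require Import structures.
From mathcomp Require Import all_boot all_order all_algebra all_field.
From mathcomp Require Import boolp classical_sets reals.
From mathcomp Require Import complex monalg.

Set Implicit Arguments.
Unset Strict Implicit.
Unset Printing Implicit Defensive.

Import GRing.Theory.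
Local Open Scope ring_scope.

(** Write M for the image of f, a C[t]-subalgebra of A[t]. Since the f(p_k) are
    combinations of f(q_1), ..., f(q_n), the latter span M over C[t]
    ([image_tcomb]). On the other hand M contains a multiple t^s r of every r
    in A, so it has rank n = dim A, and n generators of a lattice of rank n are
    independent: this is the determinant argument of [tcomb_eq0]. Hence
    d_i |-> f(q_i) identifies V[t] with M. By the choice of the
    structure constants this bijection turns *_t into the product of A[t],
    whence associativity ([bilin_ext_assoc]).

    Setting t = 0 in *_t thus gives the algebra M / tM. The map C[x,y] ->
    M / tM induced by f is onto, because t goes to 0, and the point is that
    its kernel is <J> ([gen_ideal_relations0]). That J lies in the kernel, which
    is an ideal, follows from f(u) = f(u(0)) modulo tM. Conversely, let
    u = \sum_k a_k p_k be in the kernel. The coordinates of f(u) in the basis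
    f(q_i) are \sum_k a_k (zeta_{i,k} + t xi_{i,k}), and u being in the kernel
    means that they are divisible by t, that is \sum_k a_k zeta_{i,k} = 0 for
    each i. Then u = \sum_k a_k (p_k - \sum_i zeta_{i,k} q_i^0) is in J. So
    d_i |-> q_i^0 induces the isomorphism of V with N; its injectivity,
    surjectivity and multiplicativity are all read off M / tM. *)

(** * Scalars from K[t] acting on B[t] *)

Section Scalet.
Context (K : comNzRingType) (B : lalgType K).
Implicit Types (g h : {poly K}) (u v : {poly B}).

Lemma scaletDl g h u : scalet (g + h) u = scalet g u + scalet h u.
Proof. by rewrite /scalet rmorphD mulrDl. Qed.

Lemma scalet_sumr g (I : Type) (r : seq I) (F : I -> {poly B}) :
  scalet g (\sum_(i <- r) F i) = \sum_(i <- r) scalet g (F i).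
Proof. exact: mulr_sumr. Qed.

Lemma scaletA g h u : scalet g (scalet h u) = scalet (g * h) u.
Proof. by rewrite /scalet rmorphM mulrA. Qed.

Lemma scalet0l u : scalet 0 u = 0.
Proof. by rewrite /scalet rmorph0 mul0r. Qed.

Lemma scaletX u : scalet 'X u = 'X * u.
Proof. by rewrite /scalet map_polyX. Qed.

Lemma scaletC c (b : B) : scalet c%:P b%:P = (c *: b)%:P.
Proof. by rewrite /scalet map_polyC /= -polyCM mulr_algl. Qed.

Lemma scalet_horner0 g u : (scalet g u).[0] = g.[0] *: u.[0].
Proof.
by rewrite !horner_coef0 /scalet coefM big_ord1 coef_map /= mulr_algl.
Qed.

Lemma scalet_mull g u v : scalet g u * v = scalet g (u * v).
Proof. by rewrite /scalet mulrA. Qed.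

End Scalet.

(** Multiplication in A[t] is K[t]-linear on the right because the scalars of
    A are central; the axioms of a left algebra would not give this. *)
Lemma scalet_mulr (K : comNzRingType) (A : algType K) (g : {poly K})
  (u v : {poly A}) : u * scalet g v = scalet g (u * v).
Proof.
rewrite /scalet !mulrA; congr (_ * v); apply/polyP => j.
(* The two Cauchy sums run in opposite directions, so they agree termwise. *)
rewrite coefM coefMr; apply: eq_bigr => k _.
by rewrite coef_map /= mulr_algl mulr_algr.
Qed.

Lemma sum_delta_coord (S : pzSemiRingType) (n : nat) (g : 'I_n -> S)
    (j : 'I_n) :
  (\sum_(i < n) g i *: delta_mx 0 i : 'rV[S]_n) 0 j = g j.
Proof.
rewrite summxE (bigD1 j) //= !mxE !eqxx mulr1 big1 ?addr0 // => i ij.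
by rewrite !mxE eqxx /= eq_sym (negbTE ij) mulr0.
Qed.

(** [c |-> tcomb w c] is the K[t]-linear map V[t] -> B[t] sending the basis
    vector d_i to w_i. *)
Definition tcomb (K : comNzRingType) (B : lalgType K) (n : nat)
    (w : 'I_n -> {poly B}) (c : 'rV[{poly K}]_n) : {poly B} :=
  \sum_(i < n) scalet (c 0 i) (w i).

Section Tcomb.
Context (K : comNzRingType) (B : lalgType K) (n : nat).
Implicit Types (w : 'I_n -> {poly B}) (c d : 'rV[{poly K}]_n).

Lemma tcombD w c d : tcomb w (c + d) = tcomb w c + tcomb w d.
Proof.
by rewrite -big_split; apply: eq_bigr => i _; rewrite mxE scaletDl.
Qed.

Lemma tcombZ w g c : tcomb w (g *: c) = scalet g (tcomb w c).
Proof.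
by rewrite scalet_sumr; apply: eq_bigr => i _; rewrite mxE scaletA.
Qed.

Lemma tcomb0 w : tcomb w 0 = 0.
Proof. by rewrite /tcomb big1 // => i _; rewrite mxE scalet0l. Qed.

Lemma tcombB w c d : tcomb w (c - d) = tcomb w c - tcomb w d.
Proof. by apply/(addIr (tcomb w d)); rewrite -tcombD !subrK. Qed.

Lemma tcomb_sum w (I : Type) (r : seq I) (F : I -> 'rV[{poly K}]_n) :
  tcomb w (\sum_(i <- r) F i) = \sum_(i <- r) tcomb w (F i).
Proof. exact: (big_morph _ (tcombD w) (tcomb0 w)). Qed.

Lemma tcomb_delta w (g : 'I_n -> {poly K}) :
  tcomb w (\sum_(i < n) g i *: delta_mx 0 i) = \sum_(i < n) scalet (g i) (w i).
Proof. by apply: eq_bigr => i _; rewrite sum_delta_coord. Qed.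

Lemma tcomb_horner0 w c :
  (tcomb w c).[0] = \sum_(i < n) at_t0 c 0 i *: (w i).[0].
Proof.
by rewrite horner_sum; apply: eq_bigr => i _; rewrite scalet_horner0 mxE.
Qed.

End Tcomb.

(** * Products on free modules given by structure constants *)

Lemma bilin_ext_linear (S : comNzRingType) (n : nat)
    (T : 'I_n -> 'I_n -> 'rV[S]_n) :
  (forall u, linear (bilin_ext T u)) /\ (forall v, linear ((bilin_ext T)^~ v)).
Proof.
split=> z s x y; rewrite /bilin_ext scaler_sumr -big_split.
  apply: eq_bigr => k _; rewrite scaler_sumr -big_split /=.
  by apply: eq_bigr => l _; rewrite !mxE scalerA -scalerDl mulrDr mulrCA.
apply: eq_bigr => k _; rewrite scaler_sumr -big_split /=.
by apply: eq_bigr => l _; rewrite !mxE scalerA -scalerDl mulrDl mulrA.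
Qed.

Lemma at_t0_const (K : comNzRingType) (n : nat) (u : 'rV[K]_n) :
  at_t0 (const_t u) = u.
Proof. by apply/rowP => i; rewrite !mxE hornerC. Qed.

Lemma at_t0_bilin_ext (K : comNzRingType) (n : nat)
    (T : 'I_n -> 'I_n -> 'rV[{poly K}]_n) (u v : 'rV[{poly K}]_n) :
  at_t0 (bilin_ext T u v) =
  bilin_ext (fun k l => at_t0 (T k l)) (at_t0 u) (at_t0 v).
Proof.
apply/rowP => i; rewrite /bilin_ext mxE !summxE horner_sum.
apply: eq_bigr => k _; rewrite !summxE horner_sum.
by apply: eq_bigr => l _; rewrite !mxE !hornerM.
Qed.

(** By bilinearity it is enough that d_i |-> w_i is multiplicative on the basis
    vectors. *)
Lemma tcomb_bilin_ext (K : comNzRingType) (A : algType K) (n : nat)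
    (w : 'I_n -> {poly A}) (T : 'I_n -> 'I_n -> 'rV[{poly K}]_n)
    (wT : forall k l, w k * w l = tcomb w (T k l)) u v :
  tcomb w (bilin_ext T u v) = tcomb w u * tcomb w v.
Proof.
rewrite /bilin_ext tcomb_sum big_distrlr; apply: eq_bigr => k _.
rewrite tcomb_sum; apply: eq_bigr => l _ /=.
by rewrite tcombZ -wT scalet_mulr scalet_mull scaletA mulrC.
Qed.

(** * Spanning families *)

Section LinSpan.
Context (K : nzRingType) (W : lmodType K) (g : nat -> W).

(** Both combinations are padded with zero coefficients to a common length. *)
Lemma lin_spanD u v :
  lin_span g u -> lin_span g v -> lin_span g (u + v).
Proof.
have extend m (c : nat -> K) M : (m <= M)%N -> \sum_(k < m) c k *: g k =
    \sum_(k < M) (if (k < m)%N then c k else 0) *: g k.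
  move=> mM; rewrite (big_ord_widen M (fun k => c k *: g k)) // big_mkcond.
  by apply: eq_bigr => k _; case: ifP; rewrite ?scale0r.
move=> [m [c ->]] [m' [c' ->]]; exists (maxn m m').
rewrite (extend m c _ (leq_maxl m m')) (extend m' c' _ (leq_maxr m m')).
rewrite -big_split /=.
exists (fun k => (if (k < m)%N then c k else 0) +
                 (if (k < m')%N then c' k else 0)).
by apply: eq_bigr => k _; rewrite scalerDl.
Qed.

Lemma lin_spanZ_gen c k : lin_span g (c *: g k).
Proof.
exists k.+1, (fun j => if j == k then c else 0).
rewrite big_ord_recr /= eqxx big1 ?add0r // => j _.
by rewrite ltn_eqF ?scale0r.
Qed.

Lemma lin_span0 : lin_span g 0.
Proof. by exists 0, (fun=> 0); rewrite big_ord0. Qed.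

End LinSpan.

Lemma ncmon_lin_span (K : comNzRingType) (p : nat -> {fmonom 'I_2})
    (p_surj : forall w, exists k, p k = w) (u : ncpoly K) :
  lin_span (fun k => ncmon K (p k)) u.
Proof.
rewrite (monalgE u); apply: big_ind => [||w _].
- exact: lin_span0.
- exact: lin_spanD.
have [k <-] := p_surj w.
have -> : << u@_(p k) *g p k >> = u@_(p k) *: ncmon K (p k).
  by apply/malgP => v; rewrite mcoeffZ !mcoeffU mulrnAr mulr1.
exact: lin_spanZ_gen.
Qed.

(** * Independence of n generators of a lattice of rank n *)

Section Independence.
Context (K : fieldType) (A : falgType K).

Lemma map_coord_scalet (m : nat) (e : m.-tuple A) (j : 'I_m) (g : {poly K})
    (u : {poly A}) :
  map_poly (coord e j) (scalet g u) = g * map_poly (coord e j) u.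
Proof.
apply/polyP => k; rewrite coef_map /= !coefM linear_sum /=.
by apply: eq_bigr => l _; rewrite !coef_map /= mulr_algl linearZ.
Qed.

Lemma map_coord_tcomb (m n : nat) (e : m.-tuple A) (j : 'I_m)
    (w : 'I_n -> {poly A}) (c : 'rV[{poly K}]_n) :
  map_poly (coord e j) (tcomb w c) =
  \sum_(i < n) c 0 i * map_poly (coord e j) (w i).
Proof.
rewrite raddf_sum; apply: eq_bigr => i _; exact: map_coord_scalet.
Qed.

(** Linear independence, over K[t], of n elements of A[t] whose combinations
    include a t-power multiple of every r in A, where n = dim A. In
    coordinates with respect to a basis e of A, let F be the matrix of the
    family and G that of the combinations giving the t^(s_j) e_j. Then G F is
    diagonal with powers of t on the diagonal, so det F <> 0. *)
Lemma tcomb_eq0 (n : nat) (w : 'I_n -> {poly A}) :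
    \dim {:A} = n ->
    (forall r : A, exists i (c : 'rV[{poly K}]_n), r *: 'X^i = tcomb w c) ->
  forall c, tcomb w c = 0 -> c = 0.
Proof.
move=> dimA; subst n; set n := \dim _ in w * => mult_w c wc0.
have eb := vbasisP {:A}; set e : n.-tuple A := vbasis _ in eb.
have [s sP] := choice (fun j : 'I_n => mult_w e`_j).
have [d dP] := choice sP.
pose F : 'M[{poly K}]_n := \matrix_(i, j) map_poly (coord e j) (w i).
pose G : 'M[{poly K}]_n := \matrix_(i, j) d i 0 j.
have GF : G *m F = diag_mx (\row_j 'X^(s j)).
  apply/matrixP => j l; rewrite !mxE.
  under eq_bigr do rewrite !mxE.
  rewrite -map_coord_tcomb -dP; apply/polyP => k.
  rewrite coef_map /= coefZ coefXn coefMn coefXn.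
  rewrite mulr_natr linearMn /= coord_free ?(basis_free eb) //.
  by rewrite [j == l]eq_sym; case: (l =P j) => _; case: (k == s _);
    rewrite ?mulr0n ?mulr1n.
have detF : \det F != 0.
  have : \det (G *m F) != 0.
    rewrite GF det_diag prodf_seq_neq0; apply/allP => j _.
    by rewrite mxE expf_neq0 ?polyX_eq0.
  by rewrite det_mulmx mulf_eq0 negb_or => /andP[].
have cF : c *m F = 0.
  apply/rowP => j; rewrite !mxE.
  under eq_bigr do rewrite !mxE.
  by rewrite -map_coord_tcomb wc0 raddf0.
(* Cancelling F by its adjugate avoids the fraction field of K[t]. *)
have : \det F *: c == 0.
  by rewrite -mul_mx_scalar -mul_mx_adj mulmxA cF mul0mx.
rewrite -subr_eq0 subr0 => /eqP Fc; apply/rowP => i.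
have /rowP/(_ i) := Fc; rewrite !mxE => /eqP.
by rewrite mulf_eq0 (negbTE detF) => /eqP.
Qed.

End Independence.

(** * The image of f modulo t *)

Lemma quot_pi_scale (K : nzRingType) (B : lalgType K) (J : set B) (c : K)
    (u : B) :
  quot_alg_pi J (c *: u) = c *: quot_alg_pi J u.
Proof. exact: quot_alg_piZ. Qed.

Lemma quot_pi_mul (K : nzRingType) (B : lalgType K) (J : set B) (u v : B) :
  quot_alg_pi J (u * v) = quot_alg_pi J u * quot_alg_pi J v.
Proof. exact: quot_alg_piM. Qed.


Section ImageModT.
Context (K : comNzRingType) (B : lalgType K) (A : algType K).
Context (f : {rmorphism {poly B} -> {poly A}}).
(* The case to keep in mind: B is the free algebra, e lists its monomials p_k,
   rho k is the row of the zeta_{i,k} + t xi_{i,k}, and T k l that of the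
   structure constants of *_t. *)
Context (f_scal : forall c : K, f (c%:A)%:P = (c%:A)%:P) (f_t : f 'X = 'X).
Context (n : nat) (q : 'I_n -> {poly B}).
Context (fq_inj : forall c : 'rV[{poly K}]_n, tcomb (f \o q) c = 0 -> c = 0).
Context (e : nat -> B) (e_span : forall u, lin_span e u).
Context (rho : nat -> 'rV[{poly K}]_n).
Context (f_e : forall k, f (e k)%:P = tcomb (f \o q) (rho k)).
Context (T : 'I_n -> 'I_n -> 'rV[{poly K}]_n).
Context (f_qq : forall k l, f (q k * q l) = tcomb (f \o q) (T k l)).

Local Notation F := (tcomb (f \o q)).

Lemma morph_scalet g u : f (scalet g u) = scalet g (f u).
Proof.
rewrite /scalet rmorphM; congr (_ * _).
elim/poly_ind: g => [|g c IH]; first by rewrite !rmorph0.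
by rewrite !rmorphD !rmorphM /= !map_polyX f_t IH !map_polyC /= f_scal.
Qed.

Lemma morph_tcomb c : f (tcomb q c) = F c.
Proof. by rewrite rmorph_sum; apply: eq_bigr => i _; rewrite morph_scalet. Qed.

(** The coordinates of f(u) are tracked together with an expansion of u, since
    the same coefficients have to reappear in the elements of J. *)
Lemma image_tcomb_const u : exists a : nat -> K, exists m,
  u = \sum_(k < m) a k *: e k /\
  f u%:P = F (\sum_(k < m) (a k)%:P *: rho k).
Proof.
have [m [a ->]] := e_span u; exists a, m; split=> //.
rewrite !rmorph_sum tcomb_sum; apply: eq_bigr => k _.
by rewrite tcombZ -f_e -morph_scalet scaletC.
Qed.

Lemma image_tcomb u : exists c, f u = F c.
Proof.
elim/poly_ind: u => [|u b [c fu]]; first by exists 0; rewrite rmorph0 tcomb0.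
have [a [m [_ fb]]] := image_tcomb_const b.
exists ('X *: c + \sum_(k < m) (a k)%:P *: rho k).
by rewrite rmorphD rmorphM f_t fu fb tcombD tcombZ scaletX commr_polyX.
Qed.

(** The submodule tM, where M is the image of f. *)
Definition t_image (w : {poly A}) : Prop := exists h, w = 'X * f h.

Lemma t_imageB w z : t_image w -> t_image z -> t_image (w - z).
Proof. by move=> [g ->] [h ->]; exists (g - h); rewrite rmorphB mulrBr. Qed.

Lemma t_imageD w z : t_image w -> t_image z -> t_image (w + z).
Proof. by move=> [g ->] [h ->]; exists (g + h); rewrite rmorphD mulrDr. Qed.

Lemma t_imageMl u w : t_image w -> t_image (f u * w).
Proof.
move=> [h ->]; exists (u * h).
by rewrite rmorphM !mulrA commr_polyX.
Qed.

Lemma t_imageMr u w : t_image w -> t_image (w * f u).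
Proof. by move=> [h ->]; exists (h * u); rewrite rmorphM mulrA. Qed.

(** u - u(0) is a multiple of t, and f(t) = t. *)
Lemma t_image_horner0 u : t_image (f u - f (u.[0])%:P).
Proof.
elim/poly_ind: u => [|u b _].
  by exists 0; rewrite horner0 !rmorph0 subrr mulr0.
exists u; rewrite hornerMXaddC mulr0 add0r -rmorphB addrK.
by rewrite rmorphM f_t commr_polyX.
Qed.

(** Independence of the f(q_i) makes tM the set of the combinations whose
    coordinates are all divisible by t. *)
Lemma t_image_tcomb c : t_image (F c) <-> at_t0 c = 0.
Proof.
split=> [[h]|c0].
  have [d ->] := image_tcomb h; rewrite -scaletX -tcombZ => /eqP.
  rewrite -subr_eq0 -tcombB => /eqP/fq_inj/eqP; rewrite subr_eq0 => /eqP ->.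
  by apply/rowP => i; rewrite !mxE hornerM hornerX mul0r.
have [d ->] : exists d, c = 'X *: d.
  exists (\row_i drop_poly 1 (c 0 i)); apply/rowP => i; rewrite !mxE.
  rewrite -{1}[c 0 i](poly_take_drop 1) mulrC.
  have := congr1 (fun v : 'rV_n => v 0 i) c0; rewrite !mxE horner_coef0 => ci0.
  suff -> : take_poly 1 (c 0 i) = 0 by rewrite add0r.
  by apply/polyP => -[|j]; rewrite coef_take_poly coef0 //= ci0.
by exists (tcomb q d); rewrite morph_tcomb -scaletX -tcombZ.
Qed.

(** The set J: the relations that the zeta_{i,k} impose at t = 0. *)
Definition relations0 : set B := lin_span (fun k =>
  e k - \sum_(i < n) at_t0 (rho k) 0 i *: (q i).[0]).

(** The kernel of B -> M / tM is an ideal, and it contains J because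
    e_k - \sum_i zeta_{i,k} q_i^0 is the value at 0 of an element of the kernel
    of f, while f(v) = f(v(0)) modulo tM. Conversely, if f(u) is in tM then the
    q_i^0 cancel in the combination of generators of J with the coefficients
    of u, so that this combination is u. In particular J is already an ideal. *)
Lemma gen_ideal_relations0 u : gen_ideal relations0 u <-> t_image (f u%:P).
Proof.
split=> [/(_ (fun v => t_image (f v%:P)))|fu].
  apply; split=> [|v [m [a ->]]].
    split=> [|v w fv fw|a v fv|a v fv].
    - by exists 0; rewrite !rmorph0 mulr0.
    - by rewrite polyCB rmorphB; exact: t_imageB.
    - by rewrite polyCM rmorphM; exact: t_imageMl.
    - by rewrite polyCM rmorphM; exact: t_imageMr.
  rewrite !rmorph_sum; elim/big_ind: _ => [||k _].
  - by exists 0; rewrite rmorph0 mulr0.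
  - exact: t_imageD.
  rewrite /= -scaletC morph_scalet -tcomb_horner0.
  rewrite polyCB rmorphB f_e -morph_tcomb.
  have [h ->] := t_image_horner0 (tcomb q (rho k)).
  exists (scalet (a k)%:P h).
  by rewrite morph_scalet scalet_mulr.
move=> S [_]; apply; have [a [m [u_e fu']]] := image_tcomb_const u.
move: fu; rewrite fu' => /t_image_tcomb/rowP c0; exists m, a; rewrite u_e.
(* The subtracted part is \sum_i (\sum_k a_k zeta_{i,k}) q_i^0, whose
   coefficients vanish by c0. *)
under [RHS]eq_bigr do rewrite scalerBr.
rewrite big_split /= -[LHS]addr0; congr (_ + _).
rewrite sumrN.
under eq_bigr do rewrite scaler_sumr.
rewrite exchange_big /= big1 ?oppr0 // => i _.
under eq_bigr do rewrite scalerA.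
rewrite -scaler_suml.
have := c0 i; rewrite !mxE summxE horner_sum => s0.
rewrite [X in X *: _](_ : _ = 0) ?scale0r // -[RHS]s0.
by apply: eq_bigr => k _; rewrite !mxE hornerM hornerC.
Qed.

(** V[t] is embedded in the associative algebra A[t], multiplicatively. *)
Lemma bilin_ext_assoc : associative (bilin_ext T).
Proof.
have FM u v : F (bilin_ext T u v) = F u * F v.
  by apply: tcomb_bilin_ext => k l; rewrite /= -rmorphM.
move=> u v w; apply/eqP; rewrite -subr_eq0; apply/eqP/fq_inj.
by rewrite tcombB !FM mulrA subrr.
Qed.

Definition class0 (v : 'rV[K]_n) : quot_alg relations0 :=
  quot_alg_pi relations0 (\sum_(i < n) v 0 i *: (q i).[0]).

Lemma class0_linear : linear class0.
Proof.
move=> a u v; rewrite /class0.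
rewrite -quot_pi_scale -quot_alg_piD; congr quot_alg_pi.
rewrite scaler_sumr -big_split; apply: eq_bigr => i _.
by rewrite !mxE scalerDl scalerA.
Qed.

(** The recipe for inverting [class0]: expand f(u) in the f(q_i) and put t = 0
    in the coordinates. Knowing f(u) modulo tM is enough, which is what
    multiplicativity requires. *)
Lemma class0P u c :
  t_image (f u%:P - F c) -> quot_alg_pi relations0 u = class0 (at_t0 c).
Proof.
move=> uc; apply/quot_alg_piE/gen_ideal_relations0; rewrite -tcomb_horner0.
have -> : f (u - (tcomb q c).[0])%:P =
    (f u%:P - F c) + (f (tcomb q c) - f ((tcomb q c).[0])%:P).
  by rewrite polyCB rmorphB morph_tcomb addrA subrK.
by apply: t_imageD => //; exact: t_image_horner0.
Qed.

(** If the class of [\sum_i v_i q_i^0] vanishes, then [\sum_i v_i f(q_i)] lies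
    in t times the image, so that t divides the constants [v_i]. *)
Lemma class0_eq0 v : class0 v = 0 -> v = 0.
Proof.
have pi0 : quot_alg_pi relations0 0 = 0.
  by rewrite -(scale0r 0) quot_pi_scale scale0r.
rewrite -pi0 => /quot_alg_piE/gen_ideal_relations0.
rewrite subr0 -[v in X in X -> _]at_t0_const -tcomb_horner0 => v0.
rewrite -[RHS](iffLR (t_image_tcomb (const_t v))) ?at_t0_const //.
rewrite -morph_tcomb -[f _](subrK (f ((tcomb q (const_t v)).[0])%:P)).
by apply: t_imageD => //; exact: t_image_horner0.
Qed.

Lemma class0_bij : bijective class0.
Proof.
have [g gK] : exists g, cancel g class0.
  suff: forall a, exists v, class0 v = a by move=> /choice[g gK]; exists g.
  elim/quot_alg_ind => u.
  have [c fu] := image_tcomb u%:P; exists (at_t0 c).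
  by symmetry; apply: class0P; exists 0; rewrite fu subrr rmorph0 mulr0.
exists g => // v; set v' := g _.
have : - v + v' = 0.
  apply: class0_eq0; have := class0_linear (-1) v v'.
  by rewrite !scaleN1r gK addNr.
by move/eqP; rewrite addrC subr_eq0 => /eqP.
Qed.

(** The product of the representatives [x.[0]] and [y.[0]] is [(x * y).[0]], the
    class of which is determined by f(x) f(y), a product in A[t] and so the
    image of a *_t product. *)
Lemma class0M u v :
  class0 (bilin_ext (fun k l => at_t0 (T k l)) u v) =
  class0 u * class0 v.
Proof.
rewrite -[in LHS](at_t0_const u) -[in LHS](at_t0_const v) -at_t0_bilin_ext.
rewrite /class0 -quot_pi_mul; symmetry; apply: class0P.
rewrite (tcomb_bilin_ext _) => [|k l]; last by rewrite /= -rmorphM.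
rewrite -[u in X in t_image (X - _)]at_t0_const.
rewrite -[v in X in t_image (X - _)]at_t0_const -!tcomb_horner0.
rewrite -!morph_tcomb -rmorphM; set x := tcomb _ _; set y := tcomb _ _.
have -> : x.[0] * y.[0] = (x * y).[0] by rewrite !horner_coef0 coefM big_ord1.
rewrite -opprB -sub0r; apply: t_imageB; last exact: t_image_horner0.
by exists 0; rewrite rmorph0 mulr0.
Qed.

End ImageModT.

(** * The deformation and its fiber at t = 0 *)

Theorem theorem3p8 (R : realType) (A : falgType R[i]) (n : nat)
  (dimA : \dim {:A} = n)
  (m : nat) (m_gt0 : (0 < m)%N) (a b : 'I_m -> A)
  (genA : << <<[:: \sum_(i < m) a i; \sum_(i < m) b i]>> >>%AS = {:A}%VS)
  (f : {rmorphism {poly (ncpoly R[i])} -> {poly A}})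
  (f_scal : forall c : R[i], f (c%:A)%:P = (c%:A)%:P)
  (f_x : f (ncx R[i])%:P = \sum_(i < m) a i *: 'X^(i.+1))
  (f_y : f (ncy R[i])%:P = \sum_(i < m) b i *: 'X^(i.+1))
  (f_t : f 'X = 'X)
  (im_f : forall r : A, exists (i : nat) (P : {poly (ncpoly R[i])}),
      f P = r *: 'X^i)
  (p : nat -> {fmonom 'I_2}) (p_enum : shortlex_enum p)
  (q : 'I_n -> {poly (ncpoly R[i])})
  (q_span : forall k : nat, exists g : 'I_n -> {poly R[i]},
      f (ncmon R[i] (p k))%:P = \sum_(i < n) scalet (g i) (f (q i)))
  (zeta : 'I_n -> nat -> R[i]) (xi : 'I_n -> nat -> {poly R[i]})
  (zeta_xi : forall k : nat,
      f ((ncmon R[i] (p k))%:P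
         - \sum_(i < n) scalet ((zeta i k)%:P + 'X * xi i k) (q i)) = 0)
  (zeta2 : 'I_n -> 'I_n -> 'I_n -> R[i])
  (xi2 : 'I_n -> 'I_n -> 'I_n -> {poly R[i]})
  (zeta_xi2 : forall k l : 'I_n,
      f (q k * q l
         - \sum_(i < n) scalet ((zeta2 i k l)%:P + 'X * xi2 i k l) (q i)) = 0) :
  let J := lin_span (fun k : nat =>
      ncmon R[i] (p k) - \sum_(i < n) zeta i k *: (q i).[0]) in
  let N := quot_alg J in
  let dmul (k l : 'I_n) : 'rV[{poly R[i]}]_n :=
    \sum_(i < n) ((zeta2 i k l)%:P + 'X * xi2 i k l) *: delta_mx 0 i in
  let star_t := bilin_ext dmul in
  let star_0 := bilin_ext (fun k l => at_t0 (dmul k l)) in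
  formal_deformation star_0 star_t /\
  exists phi : {linear 'rV[R[i]]_n -> N},
    bijective phi /\ {morph phi : u v / star_0 u v >-> u * v}.
Proof.
move=> J N dmul star_t star_0.
pose rho k : 'rV[{poly R[i]}]_n :=
  \sum_(j < n) ((zeta j k)%:P + 'X * xi j k) *: delta_mx 0 j.
have f_scalet := morph_scalet f_scal f_t.
have f_e k : f (ncmon R[i] (p k))%:P = tcomb (f \o q) (rho k).
  rewrite tcomb_delta; apply/eqP; rewrite -subr_eq0 -[X in _ == X](zeta_xi k).
  rewrite rmorphB rmorph_sum; apply/eqP; congr (_ - _).
  by apply: eq_bigr => j _; rewrite f_scalet.
have f_qq k l : f (q k * q l) = tcomb (f \o q) (dmul k l).
  rewrite tcomb_delta; apply/eqP; rewrite -subr_eq0.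
  rewrite -[X in _ == X](zeta_xi2 k l).
  rewrite rmorphB rmorph_sum; apply/eqP; congr (_ - _).
  by apply: eq_bigr => j _; rewrite f_scalet.
have e_span := @ncmon_lin_span R[i] p (proj2 p_enum).
have fq_inj : forall c, tcomb (f \o q) c = 0 -> c = 0.
  apply: tcomb_eq0 => // r; have [s [P fP]] := im_f r.
  have [c fc] := image_tcomb f_scal f_t e_span f_e P.
  by exists s, c; rewrite -fP.
have rho0 k j : at_t0 (rho k) 0 j = zeta j k.
  by rewrite mxE sum_delta_coord hornerD hornerC hornerM hornerX mul0r addr0.
have JE : J = relations0 q (fun k => ncmon R[i] (p k)) rho.
  rewrite /relations0; apply: (congr1 (@lin_span _ _)); apply/funext => k.
  by under [in RHS]eq_bigr do rewrite rho0.
split; first split.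
- exact: bilin_ext_linear.
- exact (bilin_ext_assoc fq_inj f_qq).
- by move=> u v; rewrite at_t0_bilin_ext !at_t0_const.
rewrite /N JE.
pose phi := class0 q (fun k => ncmon R[i] (p k)) rho.
pose phiL := GRing.isLinear.Build _ _ _ _ phi (class0_linear _ _ _).
pose phi' : {linear _ -> _} := HB.pack phi phiL.
exists phi'; split.
  exact (class0_bij f_scal f_t fq_inj e_span f_e).
exact (class0M f_scal f_t fq_inj e_span f_e f_qq).
Qed.
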